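(* Let $\{G(n)\}$ be a sequence of random intersection graphs with $n=O(m)$ and $\mathbb E\,Y(n)^2=O(1)$, and let $C=C(n)$ be the clique output by \textsc{Mono-Clique} on input $G(n)$. Then $\mathbb E\big(\omega(G(n))-|C|\big)^2=O(1)$. Furthermore, if there is a sequence $\omega_n\to\infty$ such that $\omega(G(n))\ge\omega_n$ with probability tending to $1$, then $|C|=\omega(G(n))$ with probability tending to $1$.
   Context: Random intersection graph: given positive integers $n,m$ and a probability measure $P$ on $\{0,\dots,m\}$, $G(n,m,P)$ has vertex set $V=[n]$ and attribute set $W=\{w_1,\dots,w_m\}$; independent random subsets $S_1,\dots,S_n\subseteq W$ with $\mathbb P(S_v=S)=P(|S|)/\binom{m}{|S|}$; distinct $u,v$ adjacent iff $S_u\cap S_v\ne\emptyset$. For a sequence $G(n)=G(n,m(n),P(n))$ with $m(n)\to\infty$, $X(n)$ has law $P(n)$ and $Y(n)=(n/m)^{1/2}X(n)$. $\omega$ is the clique number; $\Gamma(v)$ is the neighbourhood of $v$. Algorithm \textsc{Mono-Clique}$(G)$: for each edge $uv$ compute $D(uv)=|\Gamma(u)\cap\Gamma(v)|$; then go through the edges $uv$ in decreasing order of $D(uv)$ (ties broken arbitrarily), and for the first edge for which $S=\Gamma(u)\cap\Gamma(v)$ induces a clique, return $S\cup\{u,v\}$; if there is no such edge, return $\{1\}\cap V(G)$. *)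

(* Defs.v *)
From Stdlib Require Import Reals.
From mathcomp Require Import all_boot.

Set Implicit Arguments.
Unset Strict Implicit.
Unset Printing Implicit Defensive.

(* An outcome of G(n,m,P): the family (S_v)_{v in V} of attribute sets.
   Vertices [n] = {1..n} are represented by 'I_n = {0..n-1} (vertex k+1 <-> k);
   attributes w_1..w_m by 'I_m. *)
Definition outcome (n m : nat) : finType := {ffun 'I_n -> {set 'I_m}}.

Section Graph.
Variables (n m : nat) (S : outcome n m).

Definition adj (u v : 'I_n) : bool := (u != v) && (S u :&: S v != set0).

Definition nbhd (u : 'I_n) : {set 'I_n} := [set v | adj u v].

Definition is_clique (A : {set 'I_n}) : bool :=
  [forall u in A, forall v in A, (u != v) ==> adj u v].

Definition clique_number : nat := (\max_(A : {set 'I_n} | is_clique A) #|A|)%N.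

Definition is_edge (e : 'I_n * 'I_n) : bool := (e.1 < e.2)%N && adj e.1 e.2.

Definition common (e : 'I_n * 'I_n) : {set 'I_n} := nbhd e.1 :&: nbhd e.2.

Definition Dval (e : 'I_n * 'I_n) : nat := #|common e|.

(* Run through the edges in the given order; return S cup {u,v} for the first
   edge whose S = Gamma(u) cap Gamma(v) induces a clique; otherwise {1} cap V
   (vertex 1 is the element 0 of 'I_n). *)
Fixpoint mono_run (L : seq ('I_n * 'I_n)) : {set 'I_n} :=
  match L with
  | [::] => [set x : 'I_n | val x == 0%N]
  | e :: L' => if is_clique (common e) then common e :|: [set e.1; e.2]
               else mono_run L'
  end.

Definition valid_edge_order (L : seq ('I_n * 'I_n)) : Prop :=
  uniq L /\ (forall e, (e \in L) = is_edge e) /\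
  sorted (fun e f => (Dval f <= Dval e)%N) L.

(* C is a possible output of Mono-Clique(G) (for some tie-breaking) *)
Definition mono_clique_output (C : {set 'I_n}) : Prop :=
  exists L, valid_edge_order L /\ C = mono_run L.

End Graph.

Local Open Scope R_scope.

(* P(S_v = S) = P(|S|) / binom(m, |S|), independently over v *)
Definition weight (n m : nat) (P : nat -> R) (S : outcome n m) : R :=
  foldr Rmult 1
    (map (fun v : 'I_n => P #|S v| / INR 'C(m, #|S v|)) (enum 'I_n)).

Definition Exp (n m : nat) (P : nat -> R) (f : outcome n m -> R) : R :=
  foldr Rplus 0
    (map (fun S : outcome n m => weight P S * f S) (enum (outcome n m))).

Definition Prob (n m : nat) (P : nat -> R) (E : outcome n m -> bool) : R :=
  Exp P (fun S => if E S then 1 else 0).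

(* Main.v *)
(* Call an ordered pair (u, v) bad if u and v share two attributes, or if some
   vertex x forms a triangle with them whose three sides are witnessed by three
   distinct attributes.  If an adjacent pair is not bad, then it shares a single
   attribute c, and every common neighbour of u and v must also hold c; so the
   common neighbourhood is a clique, and together with u, v it contains every
   clique through u and v.  Hence Mono-Clique is optimal as soon as a maximum
   clique has a pair that is not bad; otherwise all omega (omega - 1) ordered
   pairs of that clique are bad.  In all cases (omega - |C|)^2 is at most twice
   the number of bad pairs, and omega^2 is so whenever |C| <> omega.

   A vertex holds two given attributes with probability at most E X^2 / m^2.  By
   independence the expected number of bad pairs is therefore at most
   t^2 + t^3 with t = n m (E X^2 / m^2) = E Y^2, which is O(1).  The first claim
   follows by taking expectations and the second one from Markov's inequality. *)
Require Import Defs.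
From Stdlib Require Import Reals.
From mathcomp Require Import all_boot all_order all_algebra.
From mathcomp Require Import Rstruct ring lra.

Set Implicit Arguments.
Unset Strict Implicit.
Unset Printing Implicit Defensive.

Import Order.TTheory GRing.Theory Num.Theory.

(** * Deterministic part, for one fixed outcome: bad pairs control the deficit of the output *)

Section MonoClique.
Local Open Scope nat_scope.
Variables (n m : nat) (S : outcome n m).

Definition double_link (u v : 'I_n) (a b : 'I_m) : bool :=
  [&& u != v, a != b, [set a; b] \subset S u & [set a; b] \subset S v].

(* The sides uv, ux and vx are witnessed by c, b and a respectively. *)
Definition rainbow_triangle (u v x : 'I_n) (a b c : 'I_m) : bool :=
  [&& [&& u != v, u != x & v != x], [&& a != b, a != c & b != c],
      [set c; b] \subset S u, [set c; a] \subset S v & [set a; b] \subset S x].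

Definition bad_pair (u v : 'I_n) : bool :=
  [exists a, exists b, double_link u v a b] ||
  [exists x, exists a, exists b, exists c, rainbow_triangle u v x a b c].

Definition bad_count : nat := #|[set e : 'I_n * 'I_n | bad_pair e.1 e.2]|.

Lemma adj_sym u v : adj S u v = adj S v u.
Proof. by rewrite /adj eq_sym setIC. Qed.

Lemma adjP u v : reflect (u != v /\ exists c, c \in S u /\ c \in S v) (adj S u v).
Proof.
apply: (iffP andP) => -[uv H]; split=> //.
  by case/set0Pn: H => c; rewrite inE => /andP[? ?]; exists c.
by case: H => c [cu cv]; apply/set0Pn; exists c; rewrite inE cu.
Qed.

Lemma is_cliqueP (A : {set 'I_n}) :
  reflect {in A &, forall u v, u != v -> adj S u v} (is_clique S A).
Proof.
apply: (iffP forallP) => [H u v uA vA uv | H u].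
  by move/implyP/(_ uA)/forallP/(_ v)/implyP/(_ vA)/implyP/(_ uv): (H u).
apply/implyP => uA; apply/forallP => v; apply/implyP => vA; apply/implyP.
exact: H.
Qed.

Lemma clique_number_ge (A : {set 'I_n}) : is_clique S A -> #|A| <= clique_number S.
Proof. by move=> HA; rewrite /clique_number; apply: leq_bigmax_cond. Qed.

Lemma clique_number_attained : exists2 A, is_clique S A & #|A| = clique_number S.
Proof.
have H0 : is_clique S set0 by apply/is_cliqueP => u v; rewrite inE.
rewrite /clique_number (bigop.bigmax_eq_arg set0) //.
by case: arg_maxnP => // A HA _; exists A.
Qed.

Lemma in_common u v x : (x \in common S (u, v)) = adj S u x && adj S v x.
Proof. by rewrite !inE. Qed.

Lemma common_sym u v : common S (u, v) = common S (v, u).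
Proof. by rewrite /common setIC. Qed.

Lemma edge_closure_clique u v : adj S u v -> is_clique S (common S (u, v)) ->
  is_clique S (common S (u, v) :|: [set u; v]).
Proof.
move=> uv /is_cliqueP H; apply/is_cliqueP => x y.
rewrite !in_setU !in_set1.
case/orP=> [xC | /orP[]/eqP->]; case/orP=> [yC | /orP[]/eqP->]; rewrite ?eqxx //.
- exact: H.
- by move: xC; rewrite in_common adj_sym => /andP[].
- by move: xC; rewrite in_common andbC adj_sym => /andP[].
- by move: yC; rewrite in_common => /andP[].
- by move: yC; rewrite in_common => /andP[].
- by rewrite adj_sym.
Qed.

Lemma card_edge_closure u v : u != v ->
  #|common S (u, v) :|: [set u; v]| = (Dval S (u, v)).+2.
Proof.
move=> uv; rewrite cardsU cards2 uv /Dval.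
suff -> : common S (u, v) :&: [set u; v] = set0 by rewrite cards0 subn0 addn2.
apply/setP => x; rewrite in_setI in_common in_setU !in_set1 in_set0.
by apply/negbTE/andP => -[/andP[H1 H2] /orP[]/eqP E];
  move: H1 H2; rewrite E /adj eqxx ?andbF.
Qed.

Lemma mono_run_clique L : {subset L <= is_edge S} -> is_clique S (mono_run S L).
Proof.
elim: L => [|[u v] L IH] sL /=.
  by apply/is_cliqueP => x y; rewrite !inE => /eqP Ex /eqP Ey; rewrite -val_eqE /= Ex Ey.
case: ifP => [H|_]; last by apply: IH => e eL; apply: sL; rewrite inE eL orbT.
apply: edge_closure_clique H.
by move: (sL (u, v)); rewrite inE eqxx => /(_ isT) /andP[].
Qed.

(** The run stops at [e] or earlier, hence at an edge whose [Dval] is at least that of [e]; the two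
    endpoints account for the [.+2]. *)
Lemma mono_run_card_ge L e : sorted (fun e f => Dval S f <= Dval S e) L ->
  {subset L <= is_edge S} -> e \in L -> is_clique S (common S e) ->
  (Dval S e).+2 <= #|mono_run S L|.
Proof.
elim: L => [|f L IH] //= pL sL; rewrite inE => eL He.
case: ifP => [Hf|Hf].
  have De : Dval S e <= Dval S f.
    case/orP: eL => [/eqP->//|eL].
    have tr : transitive (fun e f => Dval S f <= Dval S e).
      by move=> x y z xy yz; apply: leq_trans yz xy.
    exact: (allP (order_path_min tr pL)).
  have fE : is_edge S f by apply: sL; rewrite inE eqxx.
  move: f fE De {pL sL Hf eL} => [u v] /= /andP[uv _] De.
  by rewrite card_edge_closure // -val_eqE /= ltn_eqF.
apply: IH => //; first exact: path_sorted pL.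
  by move=> g gL; apply: sL; rewrite inE gL orbT.
by case/orP: eL => // /eqP E; move: He; rewrite E Hf.
Qed.

Section Output.
Variables (C : {set 'I_n}) (HC : mono_clique_output S C).

Lemma output_le : #|C| <= clique_number S.
Proof.
case: HC => L [[_ [EL _]] ->]; apply: clique_number_ge; apply: mono_run_clique.
by move=> e; rewrite EL.
Qed.

Lemma output_ge_edge u v : adj S u v -> is_clique S (common S (u, v)) ->
  (Dval S (u, v)).+2 <= #|C|.
Proof.
case: HC => L [[_ [EL sL]] ->].
(* The list holds each edge once, smaller endpoint first, while [common] is symmetric in the
   endpoints. *)
wlog uv : u v / u < v => [W|] Auv Hc.
  case: (ltngtP u v) => [uv|vu|/val_inj E].
  - exact: W.
  - by rewrite /Dval common_sym; apply: W; rewrite // 1?adj_sym // common_sym.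
  - by move: Auv; rewrite E /adj eqxx.
apply: mono_run_card_ge Hc => //; first by move=> e; rewrite EL.
by rewrite EL /is_edge /= uv.
Qed.

(** Because the fallback output is a vertex, a suboptimal run forces a maximum clique with at least
    two vertices. *)
Lemma output_gt0 : 0 < n -> 0 < #|C|.
Proof.
case: HC => L [_ ->] n0; elim: L => [|e L IH] /=.
  by apply/card_gt0P; exists (Ordinal n0); rewrite inE.
by case: ifP => // _; apply/card_gt0P; exists e.1; rewrite !inE eqxx orbT.
Qed.

(** Let [b] witness the side ux and [a] the side vx. If both differ from [c], then [a = b] makes
    [c], [a] a double link of u and v, and [a != b] makes a rainbow triangle. *)
Lemma good_pair_common u v c x : u != v -> ~~ bad_pair u v ->
  c \in S u -> c \in S v -> x \in common S (u, v) -> c \in S x.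
Proof.
move=> uv; rewrite negb_or => /andP[Hd Hr] cu cv.
rewrite in_common => /andP[/adjP[ux [b [bu bx]]] /adjP[vx [a [av ax]]]].
have [->//|ca] := eqVneq c a; have [->//|cb] := eqVneq c b.
have [ab|ab] := eqVneq a b.
  case/negP: Hd; apply/existsP; exists c; apply/existsP; exists a.
  by rewrite /double_link uv ca !subUset !sub1set cu cv av ab bu.
case/negP: Hr; apply/existsP; exists x; apply/existsP; exists a.
apply/existsP; exists b; apply/existsP; exists c.
rewrite /rainbow_triangle uv ux vx ab eq_sym ca eq_sym cb.
by rewrite !subUset !sub1set cu bu cv av ax bx.
Qed.

Lemma good_pair_output A u v : is_clique S A -> u \in A -> v \in A -> u != v ->
  ~~ bad_pair u v -> #|A| <= #|C|.
Proof.
move=> /is_cliqueP HA uA vA uv good; have Auv := HA u v uA vA uv.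
have [_ [c [cu cv]]] := adjP _ _ Auv.
have Hcom : is_clique S (common S (u, v)).
  apply/is_cliqueP => x y xC yC xy; apply/adjP; split=> //.
  by exists c; split; apply: good_pair_common cu cv _.
apply: leq_trans (output_ge_edge Auv Hcom); rewrite -card_edge_closure //.
apply: subset_leq_card; apply/subsetP => x xA; rewrite !in_setU !in_set1 in_common.
have [->|xu] := eqVneq x u; first by rewrite orbT.
have [->|xv] := eqVneq x v; first by rewrite !orbT.
by rewrite !HA // 1?eq_sym.
Qed.

Lemma output_optimal_or_bad : #|C| != clique_number S ->
  clique_number S ^ 2 <= 2 * bad_count.
Proof.
case: clique_number_attained => A HA EA neq.
have ltC : #|C| < #|A| by rewrite EA ltn_neqAle neq output_le.
have n0 : 0 < n.
  by apply: leq_trans (leq_trans (ltC) _); rewrite // -[leqRHS]card_ord max_card.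
have A2 : 1 < #|A| by apply: leq_trans (ltC); rewrite ltnS output_gt0.
(* Ordered pairs of distinct vertices of [A]: a single good one would give an output at least as
   large as [A]. *)
have sub : setX A A :\: [set (u, u) | u in A] \subset [set e | bad_pair e.1 e.2].
  apply/subsetP => -[u v]; rewrite !inE /= => /and3P[uv uA vA].
  have {}uv : u != v.
    by apply: contraNneq uv => ->; apply/imsetP; exists v.
  by apply: contraLR ltC => good; rewrite -leqNgt; apply: good_pair_output good.
have := subset_leq_card sub; rewrite -/bad_count cardsD cardsX.
rewrite (setIidPr _); last first.
  by apply/subsetP => _ /imsetP[u uA ->]; rewrite inE /= uA.
rewrite card_imset; last by move=> u v [].
rewrite -EA => H; rewrite -mulnn.
(* With [#|A| = k + 2], it remains to see that (k + 2)^2 <= 2 (k + 1) (k + 2); this is the origin of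
   the factor 2. *)
case: #|A| A2 H => [|[|k]] // _; rewrite -{3}[k.+2]mul1n -mulnBl subn1 /=.
move=> /(leq_mul (leqnn 2)); apply: leq_trans; rewrite mulnA leq_mul2r /=.
by rewrite mul2n -addnn -addSnnS leq_addr.
Qed.

Lemma output_deficit : (clique_number S - #|C|) ^ 2 <= 2 * bad_count.
Proof.
case: (eqVneq #|C| (clique_number S)) => [->|/output_optimal_or_bad].
  by rewrite subnn.
by apply: leq_trans; rewrite leq_sqr leq_subr.
Qed.

End Output.
End MonoClique.

(** The ratio of the binomials is k (k - 1) / (m (m - 1)), at most (k / m)^2 since k <= m. Writing
    [m - k] rather than [k - 2] below keeps the count equal to 0 for k < 2, where truncated
    subtraction would give 1. *)
Lemma bin_supersets_le m k : (1 < m)%N -> (k <= m)%N ->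
  ('C(m - 2, m - k) * m ^ 2 <= k ^ 2 * 'C(m, k))%N.
Proof.
move=> m2 km; have E1 : (m * 'C(m.-1, m - k) = k * 'C(m, k))%N.
  by rewrite mul_bin_down subKn // bin_sub.
have := mul_bin_down m.-1 (m - k).
have -> : (m.-1 - (m - k) = k.-1)%N.
  by rewrite -subn1 subnAC subKn // subn1.
move=> E2; rewrite -(@leq_pmul2l m.-1) -?subn1 ?subn_gt0 // subn1.
rewrite subn2 mulnA E2 -!mulnn.
have -> : (k.-1 * 'C(m.-1, m - k) * (m * m) = k.-1 * m * (k * 'C(m, k)))%N.
  by rewrite -E1 -!mulnA; congr (_ * _)%N; rewrite mulnC -mulnA.
rewrite -[(k * k * _)%N]mulnA [leqRHS]mulnA leq_mul2r; apply/orP; right.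
by rewrite -!subn1 !mulnBl !mul1n (mulnC k) leq_sub2l.
Qed.

(** * The law of the attribute sets and the chance of holding two given attributes *)

Section Law.
Local Open Scope ring_scope.
Variables (n m : nat) (P : nat -> R).

Definition attr_prob (T : {set 'I_m}) : R := (P #|T| / 'C(m, #|T|)%:R)%R.

Lemma weightE (S : outcome n m) : weight P S = \prod_v attr_prob (S v).
Proof.
rewrite /weight foldrE big_map big_enum /=.
by apply: eq_bigr => v _; rewrite INRE.
Qed.

Lemma ExpE (f : outcome n m -> R) :
  Exp P f = \sum_(S : outcome n m) (\prod_v attr_prob (S v)) * f S.
Proof.
rewrite /Exp foldrE big_map big_enum /=.
by apply: eq_bigr => S _; rewrite weightE.
Qed.

(* Independence: the expectation of a product over the vertices factorizes. *)
Lemma Exp_containment (A : 'I_n -> {set 'I_m}) :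
  Exp P (fun S : outcome n m => [forall v, A v \subset S v]%:R) =
  \prod_v \sum_(T : {set 'I_m} | A v \subset T) attr_prob T.
Proof.
rewrite ExpE.
under [RHS]eq_bigr do rewrite big_mkcond /=.
rewrite bigA_distr_bigA /=; apply: eq_bigr => S _.
case: forallP => [H|H]; first by rewrite mulr1; apply: eq_bigr => v _; rewrite H.
have [v Hv] : exists v, ~~ (A v \subset S v).
  by apply/existsP; rewrite -negb_forall; apply/forallP.
by rewrite mulr0 (bigD1 v) //= (negbTE Hv) mul0r.
Qed.

(** Complementation maps these supersets bijectively onto the subsets of [~: A] of size [m - k]. *)
Lemma card_supersets_draws (A : {set 'I_m}) k : (k <= m)%N ->
  #|[set T : {set 'I_m} | A \subset T & #|T| == k]| = 'C(m - #|A|, m - k).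
Proof.
move=> km.
have -> : 'C(m - #|A|, m - k) = #|[set T : {set 'I_m} | T \subset ~: A & #|T| == (m - k)%N]|.
  by rewrite cards_draws [#|~: A|]cardsCs setCK card_ord.
rewrite -[RHS](card_imset _ (@setC_inj 'I_m)); apply: eq_card => T.
have cT := cardsC T; rewrite card_ord in cT.
rewrite inE; apply/andP/imsetP => [[AT /eqP Tk]|[B]].
  exists (~: T); last by rewrite setCK.
  by rewrite inE setCS AT -[X in (X - _)%N]cT Tk addKn /=.
rewrite inE => /andP[BA /eqP Bk] E; move: cT; rewrite E setCK Bk => cT.
rewrite -setCS setCK; split=> //.
by rewrite -(eqn_add2r (m - k)) cT subnKC.
Qed.

Lemma sum_by_card (Q : pred {set 'I_m}) :
  \sum_(T : {set 'I_m} | Q T) attr_prob T =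
  \sum_(k < m.+1) #|[set T | Q T & #|T| == k]|%:R * (P k / 'C(m, k)%:R).
Proof.
have H (T : {set 'I_m}) : (#|T| < m.+1)%N.
  by rewrite ltnS; apply: leq_trans (max_card _) _; rewrite card_ord.
rewrite (partition_big (fun T => Ordinal (H T)) predT) //=.
apply: eq_bigr => k _.
rewrite (eq_bigr (fun=> P k / 'C(m, k)%:R)); last first.
  by move=> T /andP[_ /eqP <-].
rewrite sumr_const mulr_natl; congr (_ *+ _).
by apply: eq_card => T; rewrite !inE.
Qed.

Hypothesis P_ge0 : forall k, 0 <= P k.
Hypothesis P_sum : \sum_(k < m.+1) P k = 1.

Lemma attr_prob_ge0 T : 0 <= attr_prob T.
Proof. by rewrite divr_ge0. Qed.

Lemma attr_prob_sum : \sum_T attr_prob T = 1.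
Proof.
rewrite sum_by_card -[RHS]P_sum; apply: eq_bigr => k _.
have -> : #|[set T : {set 'I_m} | true & #|T| == k]| = 'C(m, k).
  have := cards_draws [set: 'I_m] k; rewrite cardsT card_ord => <-.
  by apply: eq_card => T; rewrite !inE subsetT.
have km : (k <= m)%N by rewrite -ltnS.
by rewrite mulrC divfK // pnatr_eq0 -lt0n bin_gt0.
Qed.

(** This is E X^2 / m^2, so that n m [pair_bound] equals E Y^2. *)
Definition pair_bound : R := ((\sum_(k < m.+1) k%:R ^+ 2 * P k) / m%:R ^+ 2)%R.

Lemma pair_prob_le (a b : 'I_m) : a != b ->
  \sum_(T : {set 'I_m} | [set a; b] \subset T) attr_prob T <= pair_bound.
Proof.
move=> ab; rewrite sum_by_card /pair_bound mulr_suml; apply: ler_sum => k _.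
have km : (k <= m)%N by rewrite -ltnS.
have m2 : (1 < m)%N.
  by have := max_card (mem [set a; b]); rewrite card_ord cards2 ab.
rewrite card_supersets_draws // cards2 ab.
rewrite [leLHS]mulrCA [leRHS]mulrAC [leRHS]mulrC ler_wpM2l //.
rewrite ler_pdivrMr ?ltr0n ?bin_gt0 // mulrAC ler_pdivlMr; last first.
  by rewrite exprn_gt0 // ltr0n ltnW.
rewrite -!natrX -!natrM ler_nat; exact: bin_supersets_le.
Qed.

(** * Expectation as a positive linear functional, and the expected number of bad pairs *)

Implicit Types f g : outcome n m -> R.

Lemma Exp_le f g : (forall S, f S <= g S) -> Exp P f <= Exp P g.
Proof.
move=> fg; rewrite !ExpE; apply: ler_sum => S _; apply: ler_wpM2l => //.
by apply: prodr_ge0 => v _; apply: attr_prob_ge0.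
Qed.

Lemma Exp_sum (I : finType) (F : I -> outcome n m -> R) :
  Exp P (fun S => \sum_i F i S) = \sum_i Exp P (F i).
Proof.
rewrite ExpE; under eq_bigr do rewrite mulr_sumr.
by rewrite exchange_big; apply: eq_bigr => i _; rewrite ExpE.
Qed.

Lemma ExpD f g : Exp P (fun S => f S + g S) = Exp P f + Exp P g.
Proof. by rewrite !ExpE -big_split; apply: eq_bigr => S _; rewrite mulrDr. Qed.

Lemma ExpZ c f : Exp P (fun S => c * f S) = c * Exp P f.
Proof. by rewrite !ExpE mulr_sumr; apply: eq_bigr => S _; rewrite mulrCA. Qed.

Lemma Exp_const c : Exp P (fun _ : outcome n m => c) = c.
Proof.
rewrite ExpE -mulr_suml -(bigA_distr_bigA (fun _ => attr_prob)) /=.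
by rewrite big1 ?mul1r // => v _; apply: attr_prob_sum.
Qed.

Lemma Exp_ge0 f : (forall S, 0 <= f S) -> 0 <= Exp P f.
Proof. by move=> f0; rewrite -[leLHS](Exp_const 0); apply: Exp_le. Qed.

(** Vertices outside [U] are given the empty requirement, whose factor is the total mass 1; each
    vertex of [U] contributes at most [pair_bound]. *)
Lemma pair_containment_le (U : {set 'I_n}) (a b : 'I_n -> 'I_m) :
  {in U, forall v, a v != b v} ->
  Exp P (fun S : outcome n m => [forall v in U, [set a v; b v] \subset S v]%:R)
    <= pair_bound ^+ #|U|.
Proof.
move=> ab.
have -> : Exp P (fun S : outcome n m => [forall v in U, [set a v; b v] \subset S v]%:R) =
    Exp P (fun S : outcome n m => [forall v, (if v \in U then [set a v; b v] else set0) \subset S v]%:R).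
  rewrite !ExpE; apply: eq_bigr => S _; congr (_ * (nat_of_bool _)%:R).
  by apply: eq_forallb => v; case: ifP => //= _; rewrite sub0set.
rewrite Exp_containment -prodr_const [leRHS]big_mkcond /=; apply: ler_prod => v _.
rewrite sumr_ge0 => [|T _]; last exact: attr_prob_ge0.
case: ifP => [vU|_]; first by apply: pair_prob_le; apply: ab.
by rewrite -[leRHS]attr_prob_sum (eq_bigl predT) ?lexx // => T; rewrite sub0set.
Qed.


Lemma Exp_event_le (E F : pred (outcome n m)) : (forall S, E S -> F S) ->
  Exp P (fun S => (E S)%:R) <= Exp P (fun S => (F S)%:R).
Proof.
move=> sEF; apply: Exp_le => S; rewrite ler_nat.
by case ES: (E S) => //; rewrite (sEF S ES).
Qed.

Lemma Exp_count_le (I : finType) (Q : I -> pred (outcome n m)) c :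
  (forall t, Exp P (fun S => (Q t S)%:R) <= c) ->
  Exp P (fun S => #|[set t | Q t S]|%:R) <= #|I|%:R * c.
Proof.
move=> Qc; rewrite mulr_natl -sumr_const.
apply: le_trans (ler_sum _ (fun t _ => Qc t)); rewrite -Exp_sum.
apply: Exp_le => S; rewrite -sum1_card natr_sum big_mkcond /=.
by apply: ler_sum => t _; rewrite inE; case: ifP.
Qed.

Lemma pair_bound_ge0 : 0 <= pair_bound.
Proof. by rewrite divr_ge0 ?exprn_ge0 ?sumr_ge0 // => k _; rewrite mulr_ge0 ?exprn_ge0. Qed.

Lemma Exp_false_le (E : pred (outcome n m)) c : E =1 pred0 -> 0 <= c ->
  Exp P (fun S => (E S)%:R) <= c.
Proof. by move=> E0 c0; rewrite -[leRHS]Exp_const; apply: Exp_le => S; rewrite E0. Qed.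

Lemma Exp_double_link_le u v a b :
  Exp P (fun S : outcome n m => (double_link S u v a b)%:R) <= pair_bound ^+ 2.
Proof.
have [/andP[uv ab]|H] := boolP ((u != v) && (a != b)); last first.
  apply: Exp_false_le; last by rewrite exprn_ge0 ?pair_bound_ge0.
  by move=> S; apply/negbTE; apply: contra H => /and4P[-> ->].
have := @pair_containment_le [set u; v] (fun=> a) (fun=> b) (fun _ _ => ab).
rewrite cards2 uv; apply: le_trans; apply: Exp_event_le => S /and4P[_ _ Su Sv].
by apply/forall_inP => x; rewrite in_set2 => /orP[]/eqP->.
Qed.

Lemma Exp_rainbow_triangle_le u v x a b c :
  Exp P (fun S : outcome n m => (rainbow_triangle S u v x a b c)%:R)
    <= pair_bound ^+ 3.
Proof.
have [/andP[/and3P[uv ux vx] /and3P[ab ac bc]]|H] := boolP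
    ([&& u != v, u != x & v != x] && [&& a != b, a != c & b != c]); last first.
  apply: Exp_false_le; last by rewrite exprn_ge0 ?pair_bound_ge0.
  by move=> S; apply/negbTE; apply: contra H => /and5P[-> ->].
(* On the three vertices the required pairs become {c, b} at [u], {c, a} at [v] and {a, b} at
   [x]. *)
pose a' y := if y == x then a else c; pose b' y := if y == v then a else b.
have ab' : {in x |: [set u; v], forall y, a' y != b' y}.
  move=> y; rewrite in_setU1 in_set2 /a' /b'; case/or3P => /eqP->.
  - by rewrite eqxx (eq_sym x) (negbTE vx).
  - by rewrite (negbTE ux) (negbTE uv) eq_sym.
  - by rewrite (negbTE vx) eqxx eq_sym.
have := pair_containment_le ab'.
rewrite cardsU1 cards2 uv in_set2 negb_or !(eq_sym x) ux vx.
apply: le_trans; apply: Exp_event_le => S /and5P[_ _ Su Sv Sx].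
apply/forall_inP => y; rewrite in_setU1 in_set2 /a' /b'; case/or3P => /eqP->.
- by rewrite eqxx (eq_sym x) (negbTE vx).
- by rewrite (negbTE ux) (negbTE uv).
- by rewrite (negbTE vx) eqxx.
Qed.

(** A double link involves two vertices and two attributes, a rainbow triangle three of each, so the
    numbers of tuples, (n m)^2 and (n m)^3, match the powers of [pair_bound]. *)
Lemma Exp_bad_count_le :
  Exp P (fun S : outcome n m => (bad_count S)%:R) <=
  (n%:R * m%:R * pair_bound) ^+ 2 + (n%:R * m%:R * pair_bound) ^+ 3.
Proof.
pose D (t : 'I_n * 'I_n * ('I_m * 'I_m)) (S : outcome n m) :=
  double_link S t.1.1 t.1.2 t.2.1 t.2.2.
pose T (t : 'I_n * 'I_n * 'I_n * ('I_m * 'I_m * 'I_m)) (S : outcome n m) :=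
  rainbow_triangle S t.1.1.1 t.1.1.2 t.1.2 t.2.1.1 t.2.1.2 t.2.2.
(* The bad pairs are covered by the projections of the two sets of witnessing tuples to their first
   two vertices. *)
have bad_le S : (bad_count S <= #|[set t | D t S]| + #|[set t | T t S]|)%N.
  apply: leq_trans (leq_add (leq_imset_card (fun t => t.1) _)
                            (leq_imset_card (fun t => t.1.1) _)).
  apply: leq_trans (leq_card_setU _ _); apply: subset_leq_card.
  apply/subsetP => -[u v]; rewrite inE in_setU => /orP[].
    move=> /existsP[a /existsP[b H]]; apply/orP; left.
    by apply/imsetP; exists ((u, v), (a, b)); rewrite ?inE.
  move=> /existsP[x /existsP[a /existsP[b /existsP[c H]]]]; apply/orP; right.
  by apply/imsetP; exists ((u, v, x), (a, b, c)); rewrite ?inE.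
have DT : Exp P (fun S : outcome n m => (bad_count S)%:R) <=
    Exp P (fun S => #|[set t | D t S]|%:R + #|[set t | T t S]|%:R).
  by apply: Exp_le => S; rewrite -natrD ler_nat.
apply: le_trans DT _; rewrite ExpD; apply: lerD.
  have := Exp_count_le (fun t => Exp_double_link_le t.1.1 t.1.2 t.2.1 t.2.2).
  by rewrite !card_prod !card_ord !natrM -!expr2 -!exprMn.
have := Exp_count_le (fun t => Exp_rainbow_triangle_le
   t.1.1.1 t.1.1.2 t.1.2 t.2.1.1 t.2.1.2 t.2.2).
by rewrite !card_prod !card_ord !natrM -!expr2 -!exprSr -!exprMn.
Qed.

Lemma ProbE (E : outcome n m -> bool) : Prob P E = Exp P (fun S => (E S)%:R).
Proof. by rewrite /Prob !ExpE; apply: eq_bigr => S _; case: (E S). Qed.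

Lemma Prob_le1 (E : outcome n m -> bool) : Prob P E <= 1.
Proof.
rewrite ProbE -[leRHS]Exp_const; apply: Exp_le => S.
by case: (E S).
Qed.

(** * Transfer of the bounds to the output of the algorithm *)

Section Output.
Variable C : outcome n m -> {set 'I_n}.
Hypothesis HC : forall S, mono_clique_output S (C S).

Lemma Exp_sqr_deficit_le :
  Exp P (fun S => ((clique_number S)%:R - #|C S|%:R) ^+ 2) <=
  2 * Exp P (fun S : outcome n m => (bad_count S)%:R).
Proof.
rewrite -ExpZ; apply: Exp_le => S; rewrite -natrB ?output_le //.
by rewrite -natrX -natrM ler_nat output_deficit.
Qed.

(** Markov's inequality in pointwise form: if the clique number is at least [w] but the output is
    not optimal, then 2 [bad_count] >= omega^2 >= W^2, so the subtracted term is at least 1. *)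
Lemma Prob_optimal_ge (w W : R) : 0 < W -> W <= w ->
  Prob P (fun S : outcome n m => w <= (clique_number S)%:R)
    - 2 / W ^+ 2 * Exp P (fun S : outcome n m => (bad_count S)%:R) <=
  Prob P (fun S => #|C S| == clique_number S).
Proof.
move=> W0 Ww; rewrite lerBlDr !ProbE -ExpZ -ExpD; apply: Exp_le => S.
have c0 : 0 <= 2 / W ^+ 2 * (bad_count S)%:R.
  by rewrite mulr_ge0 ?divr_ge0 ?exprn_ge0 // ltW.
have [_|neq] := eqVneq #|C S| (clique_number S).
  by case: (w <= _); rewrite ?lerDl // addr_ge0.
case: (boolP (w <= _)) => [wle|_]; rewrite add0r //.
rewrite mulrAC ler_pdivlMr ?exprn_gt0 // mul1r.
apply: (@le_trans _ _ ((clique_number S)%:R ^+ 2)).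
  have Wk := le_trans Ww wle; rewrite lerXn2r ?nnegrE //; exact: ltW.
by rewrite -natrX -natrM ler_nat; apply: output_optimal_or_bad neq.
Qed.

End Output.
End Law.

(** * Asymptotics: a uniform bound on the expected number of bad pairs gives both claims *)

Local Open Scope R_scope.


Theorem mainTheorem19
  (m : nat -> nat) (P : nat -> nat -> R)
  (* G(n) = G(n, m(n), P(n)); m(n) positive, P(n) a probability measure on {0..m(n)} *)
  (Hm_pos : forall n, (0 < m n)%N)
  (HP_nonneg : forall n k, 0 <= P n k)
  (HP_supp : forall n k, (m n < k)%N -> P n k = 0)
  (HP_sum : forall n, sum_f_R0 (fun k => P n k) (m n) = 1)
  (* m(n) -> infinity *)
  (Hm_inf : forall K : nat, exists N : nat, forall n, (N <= n)%N -> (K <= m n)%N)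
  (* n = O(m) *)
  (Hnm : exists c : R, exists N : nat, forall n, (N <= n)%N -> INR n <= c * INR (m n))
  (* E Y(n)^2 = (n/m) E X(n)^2 = O(1) *)
  (HY : exists K : R, exists N : nat, forall n, (N <= n)%N ->
          (INR n / INR (m n)) * sum_f_R0 (fun k => INR k ^ 2 * P n k) (m n) <= K)
  (* C(n): the output of Mono-Clique on G(n) (any tie-breaking) *)
  (C : forall n, outcome n (m n) -> {set 'I_n})
  (HC : forall n (S : outcome n (m n)), mono_clique_output S (C n S)) :
  (exists K : R, exists N : nat, forall n, (N <= n)%N ->
     Exp (P n) (fun S : outcome n (m n) =>
            (INR (clique_number S) - INR #|C n S|) ^ 2) <= K)
  /\
  (forall w : nat -> R,
     (forall K : R, exists N : nat, forall n, (N <= n)%N -> K <= w n) ->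
     Un_cv (fun n => Prob (P n) (fun S : outcome n (m n) =>
              if Rle_dec (w n) (INR (clique_number S)) then true else false)) 1 ->
     Un_cv (fun n => Prob (P n) (fun S : outcome n (m n) =>
              #|C n S| == clique_number S)) 1).
Proof.
have P1 n : (\sum_(k < (m n).+1) P n k = 1)%R.
  by have := HP_sum n; rewrite sum_f_R0E big_mkord.
have P0 n k : (0 <= P n k)%R by apply/RleP.
have [B [N0 EB]] : exists B N, forall n, (N <= n)%N ->
    (Exp (P n) (fun S : outcome n (m n) => (bad_count S)%:R) <= B)%R.
  case: HY => K [N HK]; exists (K ^+ 2 + K ^+ 3)%R, N => n Nn.
  have m0 : ((m n)%:R != 0 :> R)%R by rewrite pnatr_eq0 -lt0n.
  (* The left side is the second moment of Y(n), after cancelling one factor m. *)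
  have cK : (n%:R * (m n)%:R * pair_bound (m n) (P n) <= K)%R.
    have /RleP := HK n Nn; rewrite sum_f_R0E big_mkord RmultE RdivE !INRE.
    congr (_ <= _)%R; rewrite /pair_bound.
    under eq_bigr do rewrite RmultE RpowE INRE.
    by field.
  have c0 : (0 <= n%:R * (m n)%:R * pair_bound (m n) (P n))%R.
    by apply: mulr_ge0; [rewrite mulr_ge0 | apply: pair_bound_ge0].
  apply: le_trans (Exp_bad_count_le n (P0 n) (P1 n)) _.
  have K0 := le_trans c0 cK.
  by apply: lerD; rewrite lerXn2r.
split.
  exists (2 * B)%R, N0 => n Nn; apply/RleP.
  have := Exp_sqr_deficit_le (P0 n) (HC n).
  rewrite !ExpE.
  under eq_bigr do rewrite -!INRE -RminusE -RpowE.
  rewrite -!ExpE.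
  by move=> /le_trans; apply; rewrite ler_wpM2l // EB.
move=> w w_inf w_cv eps /RltP eps0.
have B0 : (0 <= B)%R.
  by apply: le_trans (EB N0 (leqnn _)); apply: Exp_ge0.
(* W^2 >= W >= 4 B / eps makes the Markov error 2 B / W^2 at most eps / 2. *)
set W := (1 + 4 * B / eps)%R.
have Be : (0 <= 4 * B / eps)%R by rewrite divr_ge0 ?mulr_ge0 // ltW.
have W1 : (1 <= W)%R by rewrite lerDl.
have [N1 HN1] := w_inf W.
have e2 : Rlt 0 (eps / 2)%R by apply/RltP; rewrite divr_gt0.
have [N2 HN2] := w_cv _ e2.
exists (maxn N0 (maxn N1 N2)) => n /ssrnat.leP.
rewrite !geq_max => /and3P[n0 n1 n2].
have := HN2 n (@ssrnat.leP _ _ n2).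
rewrite /R_dist.
have -> : Prob (P n) (fun S : outcome n (m n) =>
    if Rle_dec (w n) (INR (clique_number S)) then true else false) =
  Prob (P n) (fun S : outcome n (m n) => w n <= (clique_number S)%:R)%R.
  rewrite !ProbE !ExpE; apply: eq_bigr => S _; congr (_ * (nat_of_bool _)%:R)%R.
  by rewrite -INRE; case: Rle_dec => /= [/RleP->|/RleP/negbTE->].
have Ww : (W <= w n)%R by apply/RleP/HN1.
have W0 : (0 < W)%R by lra.
have := Prob_optimal_ge (P0 n) (HC n) W0 Ww.
have := Prob_le1 (P0 n) (P1 n) (fun S : outcome n (m n) => #|C n S| == clique_number S).
have BW : (2 / W ^+ 2 * Exp (P n) (fun S : outcome n (m n) => (bad_count S)%:R) <= eps / 2)%R.
  apply: (@le_trans _ _ (2 / W ^+ 2 * B)%R).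
    by apply: ler_wpM2l (EB n n0); rewrite divr_ge0 ?exprn_ge0 // ltW.
  rewrite mulrAC ler_pdivrMr ?exprn_gt0 //.
  have E1 : (W * eps = eps + 4 * B)%R by rewrite /W; field; rewrite gt_eqF.
  have -> : (eps / 2 * W ^+ 2 = W * eps / 2 * W)%R by ring.
  have BW1 : (0 <= B * (W - 1))%R by rewrite mulr_ge0 // subr_ge0.
  have eW : (0 <= eps * W)%R by rewrite mulr_ge0 // ltW.
  by rewrite E1; lra.
(* Here [p] is the probability of a large clique number, [q] that of an optimal output and [r] the
   Markov error: p - r <= q <= 1 with p > 1 - eps / 2 and r <= eps / 2. *)
move: (Prob _ _) (Prob _ _) (_ * Exp _ _)%R BW => p q r BW q1 pq.
move=> /Rabs_def2[/RltP H1 /RltP H2]; apply: Rabs_def1; apply/RltP;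
  rewrite ?RminusE ?RoppE ?R1E in H1 H2 *; lra.
Qed.
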